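(* For any $m,q,n\in\mathbb{N}$ and any sequence of complex numbers $a_N$ defined for integers $N$ in $[q,n]$, $$\sum_{N_m=q}^{n}\cdots\sum_{N_1=q}^{N_2}a_{N_m}\cdots a_{N_1}+(-1)^m\sum_{q\le N_1<\cdots<N_m\le n}a_{N_m}\cdots a_{N_1}=2\sum_{\substack{\sum i y_i=m\\ \sum y_i\text{ even}}}\prod_{i=1}^{m}\frac{1}{y_i!}\left(\frac1i\sum_{N=q}^{n}(a_N)^i\right)^{y_i}$$ and $$\sum_{N_m=q}^{n}\cdots\sum_{N_1=q}^{N_2}a_{N_m}\cdots a_{N_1}-(-1)^m\sum_{q\le N_1<\cdots<N_m\le n}a_{N_m}\cdots a_{N_1}=2\sum_{\substack{\sum i y_i=m\\ \sum y_i\text{ odd}}}\prod_{i=1}^{m}\frac{1}{y_i!}\left(\frac1i\sum_{N=q}^{n}(a_N)^i\right)^{y_i},$$ where the sums on the right run over the partitions $(y_1,\ldots,y_m)$ of $m$ for which $\sum y_i$ is even, respectively odd.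
   Context: $\mathbb{N}=\{0,1,2,\ldots\}$. A partition of $m$ is represented by the tuple $(y_1,\ldots,y_m)$ of non-negative integers with $\sum_{i=1}^m i\,y_i=m$, and $\sum y_i$ denotes $\sum_{i=1}^m y_i$. For $m=0$ there is exactly one partition, the empty one, with $\sum y_i=0$. Empty products equal $1$, empty sums equal $0$, and $0^0=1$. The first (recurrent) sum on the left ranges over all integer tuples with $q\le N_1\le N_2\le\cdots\le N_m\le n$. The second (multiple) sum ranges over strictly increasing integer tuples in $[q,n]$ and is $0$ if there are none. Both equal $1$ for $m=0$. *)

(* Defs.v *)
From mathcomp Require Import all_boot all_order all_algebra.
From mathcomp Require Import complex.
From mathcomp Require Import reals.

Set Implicit Arguments.
Unset Strict Implicit.
Unset Printing Implicit Defensive.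

Import GRing.Theory.
Local Open Scope ring_scope.

(* An m-tuple t stands for (N_1, ..., N_m), in this order.  The entries have
   type 'I_n.+1, which is the upper bound n; for q > n and m > 0 there is no
   admissible tuple, and for m = 0 the empty tuple contributes 1. *)
Definition recurrent_sum (C : comNzRingType) (m q n : nat) (a : nat -> C) : C :=
  \sum_(t : m.-tuple 'I_n.+1 |
          all (leq q) [seq val N | N <- t] && sorted leq [seq val N | N <- t])
    \prod_(i < m) a (tnth t i).

Definition multiple_sum (C : comNzRingType) (m q n : nat) (a : nat -> C) : C :=
  \sum_(t : m.-tuple 'I_n.+1 |
          all (leq q) [seq val N | N <- t] && sorted ltn [seq val N | N <- t])
    \prod_(i < m) a (tnth t i).

(* Multiplicity vectors are indexed from 0: y i is the paper's y_(i+1).  The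
   codomain 'I_m.+1 loses no partition, as i * y_i <= m forces y_i <= m. *)
Definition is_partition (m : nat) (y : {ffun 'I_m -> 'I_m.+1}) : bool :=
  (\sum_(i < m) i.+1 * y i == m)%N.

Definition nb_parts (m : nat) (y : {ffun 'I_m -> 'I_m.+1}) : nat :=
  (\sum_(i < m) y i)%N.

Definition partition_term (C : fieldType) (m q n : nat) (a : nat -> C)
    (y : {ffun 'I_m -> 'I_m.+1}) : C :=
  \prod_(i < m)
    (((y i)`!)%:R^-1 *
     ((i.+1)%:R^-1 * \sum_(q <= N < n.+1) a N ^+ i.+1) ^+ y i).

(* Main.v *)
Require Import Defs.
From mathcomp Require Import all_boot all_order all_algebra.
From mathcomp Require Import complex.
From mathcomp Require Import reals.
From mathcomp Require Import ring.

Import GRing.Theory.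
Local Open Scope ring_scope.

(** Let h_k and e_k be the recurrent and the multiple sum of length k over
    [q, n], that is, the complete and the elementary symmetric polynomials in
    a_q, ..., a_n, and let p_i be the i-th power sum of these values.  Put
    E = prod_N (1 - a_N X) and P = sum_(i >= 1) p_i X^(i-1).  Then
    - E = sum_k (-1)^k e_k X^k and E * sum_k h_k X^k = 1;
    - E has logarithmic derivative - P, hence sum_k h_k X^k has logarithmic
      derivative P;
    - for a constant c, the series exp (c * sum_i p_i X^i / i) has logarithmic
      derivative c * P, and multiplying out its factors
      exp (c * p_i X^i / i) shows that its coefficient of X^m is
      Z_m(c) = sum_y c^(sum y_i) prod_i (p_i / i)^(y_i) / y_i!,
      where y runs over the partitions of m.
    In characteristic zero a series is determined by its constant coefficient
    and its logarithmic derivative, so h_m = Z_m(1) and (-1)^m e_m = Z_m(-1).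
    In the sum, respectively the difference, of these two identities each
    partition has weight 1 + (-1)^(sum y_i), respectively 1 - (-1)^(sum y_i),
    which is 0 or 2 according to the parity of sum y_i.

    Only coefficients up to X^m matter, so series are replaced by polynomials
    modulo a power of X: values modulo X^(m+1), logarithmic derivatives modulo
    X^m, since differentiation loses one order. *)

(** * Logarithmic derivatives modulo a power of X *)

Lemma dvdp_XnP (F : fieldType) m (P : {poly F}) :
  reflect (forall k, (k < m)%N -> P`_k = 0) ('X^m %| P).
Proof.
apply: (iffP idP) => [/dvdpP[Q ->] k km | P0]; first by rewrite coefMXn km.
rewrite -[P](poly_take_drop m).
suff -> : take_poly m P = 0 by rewrite add0r dvdp_mulIr.
by apply/polyP => k; rewrite coef_take_poly coef0; case: ifP => // /P0.
Qed.

(** The equation P^`() = S * P avoids dividing by P. *)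
Definition log_deriv_mod (F : fieldType) m (P S : {poly F}) : bool :=
  'X^m %| P^`() - S * P.

Lemma log_deriv_mod1 (F : fieldType) m : log_deriv_mod F m 1 0.
Proof. by rewrite /log_deriv_mod -polyC1 derivC mul0r subr0 dvdp0. Qed.

Lemma log_deriv_modM (F : fieldType) m (P Q S T : {poly F}) :
  log_deriv_mod F m P S -> log_deriv_mod F m Q T ->
  log_deriv_mod F m (P * Q) (S + T).
Proof.
move=> hP hQ; rewrite /log_deriv_mod derivM.
have -> : P^`() * Q + P * Q^`() - (S + T) * (P * Q)
        = (P^`() - S * P) * Q + P * (Q^`() - T * Q) by ring.
by rewrite dvdp_add ?(dvdp_mulr _ hP) ?(dvdp_mull _ hQ).
Qed.

Lemma log_deriv_mod_prod (F : fieldType) m (I : Type) (r : seq I)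
    (P S : I -> {poly F}) :
  (forall i, log_deriv_mod F m (P i) (S i)) ->
  log_deriv_mod F m (\prod_(i <- r) P i) (\sum_(i <- r) S i).
Proof.
move=> h; elim: r => [|i r IHr]; first by rewrite !big_nil log_deriv_mod1.
by rewrite !big_cons log_deriv_modM.
Qed.

(** Modulo X^m, P * (Q' + S Q) vanishes because (P Q)' does, and P can be
    cancelled by multiplying by Q. *)
Lemma log_deriv_modV (F : fieldType) m (P Q S : {poly F}) :
  'X^(m.+1) %| P * Q - 1 -> log_deriv_mod F m P S -> log_deriv_mod F m Q (- S).
Proof.
move=> PQ1 hP.
have dPQ : 'X^m %| (P * Q)^`().
  apply/dvdp_XnP => k km; move/dvdp_XnP: PQ1 => /(_ k.+1 km).
  by rewrite coefB coef1 subr0 coef_deriv => ->; rewrite mul0rn.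
have PQ1m : 'X^m %| P * Q - 1 by apply: dvdp_trans PQ1; exact: dvdp_exp2l.
rewrite /log_deriv_mod.
have -> : Q^`() - - S * Q =
    ((P * Q)^`() - (P^`() - S * P) * Q) * Q
    - (P * Q - 1) * (Q^`() - - S * Q) by rewrite derivM; ring.
by rewrite dvdp_sub ?dvdp_mulr // dvdp_sub // dvdp_mulr.
Qed.

(** Characteristic zero makes the coefficient of X^(k+1) computable from the
    coefficient of X^k of the derivative. *)
Lemma log_deriv_mod_inj {F : fieldType} (char0 : [pchar F] =i pred0) m
    (P Q S : {poly F}) :
  P`_0 = Q`_0 -> log_deriv_mod F m P S -> log_deriv_mod F m Q S ->
  forall k, (k <= m)%N -> P`_k = Q`_k.
Proof.
move=> PQ0 /dvdp_XnP hP /dvdp_XnP hQ; elim/ltn_ind => -[//|k] IHk km.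
have := hP k km; have := hQ k km; rewrite !coefB !coef_deriv.
move=> /subr0_eq Qk /subr0_eq Pk.
have kN0 : k.+1%:R != 0 :> F by rewrite (pcharf0P F).1.
apply: (mulIf kN0); rewrite !mulr_natr Qk Pk !coefM; apply: eq_bigr => j _.
by rewrite IHk // ?ltnS ?leq_subr // (leq_trans (leq_subr _ _)) // ltnW.
Qed.

(** * Linear factors and power sums *)

(** The truncation of a / (1 - a X). *)
Definition geom_poly {F : fieldType} m (a : F) : {poly F} :=
  \poly_(j < m) a ^+ j.+1.

Lemma log_deriv_mod_linear (F : fieldType) m (a : F) :
  log_deriv_mod F m (1 - a *: 'X) (- geom_poly m a).
Proof.
have -> : geom_poly m a = a%:P * \sum_(j < m) (a *: 'X) ^+ j.
  rewrite /geom_poly poly_def mulr_sumr; apply: eq_bigr => j _.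
  by rewrite exprZn mul_polyC scalerA exprS.
rewrite /log_deriv_mod derivB derivZ derivX -polyC1 derivC sub0r polyC1.
set g := \sum_(j < m) _.
have -> : - (a *: 1) - - (a%:P * g) * (1 - a *: 'X)
    = - (a%:P * (1 + (a *: 'X - 1) * g)) by rewrite -mul_polyC; ring.
by rewrite -subrX1 addrC subrK exprZn dvdpNr dvdp_mull // -mul_polyC dvdp_mulIr.
Qed.

Lemma sum_geom_poly (F : fieldType) m q n (a : nat -> F) :
  \sum_(q <= N < n.+1) geom_poly m (a N)
  = \sum_(i < m) (\sum_(q <= N < n.+1) a N ^+ i.+1) *: 'X^i.
Proof.
rewrite (eq_bigr (fun N => \sum_(i < m) a N ^+ i.+1 *: 'X^i)); last first.
  by move=> N _; rewrite /geom_poly poly_def.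
by rewrite exchange_big /=; apply: eq_bigr => i _; rewrite scaler_suml.
Qed.

(** * Recurrent and multiple sums *)

Lemma big_cons_tuple (C : comNzRingType) (T : finType) k (P : pred (seq T))
    (f : T -> C) :
  \sum_(t : k.+1.-tuple T | P t) \prod_(i < k.+1) f (tnth t i)
  = \sum_x f x * \sum_(t : k.-tuple T | P (x :: t)) \prod_(i < k) f (tnth t i).
Proof.
under [RHS]eq_bigr do rewrite mulr_sumr.
rewrite pair_big_dep /=.
rewrite (reindex (fun p : T * k.-tuple T => cons_tuple p.1 p.2)) /=; last first.
  exists (fun t => (thead t, behead_tuple t)) => [[x t] _|t _] /=.
    by congr (_, _); apply: val_inj.
  by apply: val_inj; rewrite /= [in RHS](tuple_eta t).
apply: eq_bigr => -[x t] _; rewrite big_ord_recl /= tnth0.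
by congr (_ * _); apply: eq_bigr => i _; rewrite tnthS.
Qed.

Lemma recurrent_sum0 (C : comNzRingType) q n (a : nat -> C) :
  recurrent_sum 0 q n a = 1.
Proof.
rewrite /recurrent_sum (big_pred1 [tuple]) ?big_ord0 // => t.
by rewrite (tuple0 t) /= eqxx.
Qed.

Lemma multiple_sum0 (C : comNzRingType) q n (a : nat -> C) :
  multiple_sum 0 q n a = 1.
Proof.
rewrite /multiple_sum (big_pred1 [tuple]) ?big_ord0 // => t.
by rewrite (tuple0 t) /= eqxx.
Qed.

(** Splitting off the smallest index N leaves a tuple over [N, n]; for strictly
    increasing tuples, one over [N + 1, n]. *)
Lemma recurrent_sumS (C : comNzRingType) k q n (a : nat -> C) :
  recurrent_sum k.+1 q n a
  = \sum_(q <= N < n.+1) a N * recurrent_sum k N n a.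
Proof.
rewrite big_geq_mkord /recurrent_sum.
rewrite (big_cons_tuple _ _ k (fun s => all (leq q) [seq val N | N <- s]
  && sorted leq [seq val N | N <- s]) (fun N => a (val N))).
rewrite [RHS]big_mkcond /=; apply: eq_bigr => N _; case: leqP => qN /=.
  congr (_ * _); apply: eq_bigl => t; rewrite (path_sortedE leq_trans).
  rewrite andbA; congr (_ && _); apply: andb_idl => /allP h.
  by apply/allP => x /h; apply: leq_trans.
by rewrite big_pred0_eq mulr0.
Qed.

Lemma multiple_sumS (C : comNzRingType) k q n (a : nat -> C) :
  multiple_sum k.+1 q n a
  = \sum_(q <= N < n.+1) a N * multiple_sum k N.+1 n a.
Proof.
rewrite big_geq_mkord /multiple_sum.
rewrite (big_cons_tuple _ _ k (fun s => all (leq q) [seq val N | N <- s]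
  && sorted ltn [seq val N | N <- s]) (fun N => a (val N))).
rewrite [RHS]big_mkcond /=; apply: eq_bigr => N _; case: leqP => qN /=.
  congr (_ * _); apply: eq_bigl => t; rewrite (path_sortedE ltn_trans).
  rewrite andbA; congr (_ && _); apply: andb_idl => /allP h.
  by apply/allP => x /h; apply: leq_trans; exact: leqW.
by rewrite big_pred0_eq mulr0.
Qed.

Lemma coef_prod_linear (F : fieldType) n (a : nat -> F) q k :
  (\prod_(q <= N < n.+1) (1 - a N *: 'X))`_k = (-1) ^+ k * multiple_sum k q n a.
Proof.
(* Descending induction on q, with d bounding the length of [q, n]. *)
have [d le_nqd] : exists d, (n.+1 <= q + d)%N by exists n.+1; rewrite leq_addl.
elim: d q le_nqd k => [|d IHd] q le_nqd k.
  rewrite addn0 in le_nqd; rewrite big_geq // coef1.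
  case: k => [|k]; first by rewrite multiple_sum0 mulr1.
  by rewrite multiple_sumS big_geq // mulr0.
have [le_nq|lt_qn] := leqP n.+1 q; first by apply: (IHd q); rewrite ltn_addr.
rewrite addnS -addSn in le_nqd.
rewrite big_ltn // mulrBl mul1r -scalerAl coefB coefZ coefXM (IHd _ le_nqd).
case: k => [|k]; first by rewrite !multiple_sum0 mulr0 subr0.
rewrite (IHd _ le_nqd) !multiple_sumS [in RHS]big_ltn // exprS.
by rewrite /=; ring.
Qed.

(** Modulo X^(m+1), the factor 1 - a_q X turns the generating polynomial G over
    [q, n] into the one H over [q + 1, n]: a recurrent sum of length k + 1 over
    [q, n] whose first index is q is a_q times any recurrent sum of length k
    over [q, n]. *)
Lemma prod_linear_recurrent (F : fieldType) m n (a : nat -> F) q :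
  'X^(m.+1) %| \prod_(q <= N < n.+1) (1 - a N *: 'X) *
             \poly_(k < m.+1) recurrent_sum k q n a - 1.
Proof.
(* Descending induction on q, with d bounding the length of [q, n]. *)
have [d le_nqd] : exists d, (n.+1 <= q + d)%N by exists n.+1; rewrite leq_addl.
elim: d q le_nqd => [|d IHd] q le_nqd.
  rewrite addn0 in le_nqd; rewrite big_geq // mul1r.
  apply/dvdp_XnP => k km; rewrite coefB coef_poly km coef1.
  case: k km => [|k] _; first by rewrite recurrent_sum0 subrr.
  by rewrite recurrent_sumS big_geq // subr0.
have [le_nq|lt_qn] := leqP n.+1 q; first by apply: (IHd q); rewrite ltn_addr.
rewrite addnS -addSn in le_nqd; have := IHd _ le_nqd.
rewrite (big_ltn lt_qn).
set E := \prod_(_ <= _ < _) _; set H := \poly_(_ < _) _.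
set G := \poly_(_ < _) _ => EH1.
have -> : (1 - a q *: 'X) * E * G - 1
    = E * ((1 - a q *: 'X) * G - H) + (E * H - 1) by ring.
rewrite dvdp_add // dvdp_mull //; apply/dvdp_XnP => k km.
rewrite mulrBl mul1r -scalerAl !coefB coefZ coefXM !coef_poly km.
case: k km => [|k] km; first by rewrite !recurrent_sum0 mulr0 subr0 subrr.
rewrite /= (ltnW km) !recurrent_sumS [in X in X - _ - _]big_ltn //.
by ring.
Qed.

(** * Partitions *)

(** The truncation of exp (d X^r). *)
Definition exp_poly {F : fieldType} m r (d : F) : {poly F} :=
  \sum_(j < m.+1) ((j`!)%:R^-1 * d ^+ j) *: 'X^(r * j).

(** The only term of (d X^r)' * exp_poly that the derivative misses is the one
    of degree r - 1 + r m >= m. *)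
Lemma log_deriv_mod_exp {F : fieldType} (char0 : [pchar F] =i pred0) m i
    (d : F) :
  log_deriv_mod F m (exp_poly m i.+1 d) ((i.+1%:R * d) *: 'X^i).
Proof.
have natN0 k : k.+1%:R != 0 :> F by rewrite (pcharf0P F).1.
rewrite /log_deriv_mod /exp_poly linear_sum /= big_ord_recl /=.
rewrite muln0 !expr0 linearZ /= -polyC1 derivC scaler0 add0r.
rewrite mulr_sumr [X in _ - X]big_ord_recr /= opprD addrA -sumrB.
rewrite big1 ?sub0r => [|j _]; last first.
  rewrite linearZ /=.
  have -> : ('X^(i.+1 * bump 0 j))^`() = 'X^(i + i.+1 * j) *+ (i.+1 * j.+1)
    :> {poly F} by rewrite derivXn /bump add1n mulnS.
  rewrite /bump add1n -scalerAl -scalerAr -exprD scalerA -scaler_nat scalerA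
    -scalerBl.
  rewrite (_ : _ - _ = 0) ?scale0r // factS exprS !natrM.
  have fact_neq0 : j`!%:R != 0 :> F by case: j`! (fact_gt0 j).
  (* Both terms equal i.+1 * d ^+ j.+1 / j`!. *)
  by field; rewrite fact_neq0 nat1r natN0.
rewrite dvdpNr -scalerAl -scalerAr -exprD.
rewrite -[_ *: (_ *: _)]mul_polyC dvdp_mull // -mul_polyC dvdp_mull //.
by apply: dvdp_exp2l; rewrite mulSn addnCA leq_addr.
Qed.

(** Multiplying out, a choice of one term in each factor is a multiplicity
    vector, and the degree of the chosen product is the number that it
    partitions. *)
Lemma coef_prod_exp (F : fieldType) m q n (a : nat -> F) (c : F) :
  (\prod_(i < m) exp_poly m i.+1
     (c * (i.+1%:R^-1 * \sum_(q <= N < n.+1) a N ^+ i.+1)))`_m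
  = \sum_(y : {ffun 'I_m -> 'I_m.+1} | is_partition y)
      c ^+ nb_parts y * partition_term q n a y.
Proof.
rewrite /exp_poly bigA_distr_bigA /= coef_sum [RHS]big_mkcond /=.
apply: eq_bigr => y _.
rewrite scaler_prod -(big_morph _ (exprD 'X) (expr0 'X)) coefZ coefXn.
rewrite /is_partition eq_sym; case: eqP => _; last by rewrite mulr0.
rewrite mulr1 /partition_term /nb_parts (big_morph _ (exprD c) (expr0 c)).
rewrite -big_split /=; apply: eq_bigr => i _.
by rewrite exprMn mulrCA.
Qed.

Lemma coef0_exp_poly (F : fieldType) m i (d : F) :
  (exp_poly m i.+1 d)`_0 = 1.
Proof.
rewrite /exp_poly coef_sum big_ord_recl /= big1 => [|j _].
  by rewrite addr0 muln0 coefZ coefXn eqxx fact0 invr1 !mulr1.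
by rewrite coefZ coefXn mulnS mulr0.
Qed.

(** Both symmetric sums are recovered from this criterion, with c = 1 and
    c = - 1. *)
Lemma coef_log_deriv_power_sums {F : fieldType} (char0 : [pchar F] =i pred0)
    m q n (a : nat -> F) (c : F) (P : {poly F}) :
  P`_0 = 1 ->
  log_deriv_mod F m P (c *: \sum_(q <= N < n.+1) geom_poly m (a N)) ->
  P`_m = \sum_(y : {ffun 'I_m -> 'I_m.+1} | is_partition y)
           c ^+ nb_parts y * partition_term q n a y.
Proof.
move=> P0 hP; rewrite -coef_prod_exp.
apply: (log_deriv_mod_inj char0 m) hP _ _ _ => //.
  rewrite P0 -horner_coef0 horner_prod big1 // => i _.
  by rewrite horner_coef0 coef0_exp_poly.
rewrite sum_geom_poly scaler_sumr.
set x := fun i : 'I_m => c * (i.+1%:R^-1 * \sum_(q <= N < n.+1) a N ^+ i.+1).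
rewrite [X in log_deriv_mod _ _ _ X](eq_bigr
  (fun i : 'I_m => (i.+1%:R * x i) *: 'X^i)) => [|i _].
  by apply: log_deriv_mod_prod => i; exact: log_deriv_mod_exp.
by rewrite scalerA /x mulrCA mulVKf // (pcharf0P F).1.
Qed.

Lemma recurrent_sum_partitions {F : fieldType} (char0 : [pchar F] =i pred0)
    m q n (a : nat -> F) :
  recurrent_sum m q n a
  = \sum_(y : {ffun 'I_m -> 'I_m.+1} | is_partition y) partition_term q n a y.
Proof.
have -> : recurrent_sum m q n a = (\poly_(k < m.+1) recurrent_sum k q n a)`_m.
  by rewrite coef_poly leqnn.
rewrite (coef_log_deriv_power_sums char0 m q n a 1).
- by apply: eq_bigr => y _; rewrite expr1n mul1r.
- by rewrite coef_poly recurrent_sum0.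
rewrite scale1r -[X in log_deriv_mod _ _ _ X]opprK.
apply: log_deriv_modV (prod_linear_recurrent F m n a q) _.
by rewrite -sumrN; apply: log_deriv_mod_prod => N; exact: log_deriv_mod_linear.
Qed.

Lemma multiple_sum_partitions {F : fieldType} (char0 : [pchar F] =i pred0)
    m q n (a : nat -> F) :
  (-1) ^+ m * multiple_sum m q n a
  = \sum_(y : {ffun 'I_m -> 'I_m.+1} | is_partition y)
      (-1) ^+ nb_parts y * partition_term q n a y.
Proof.
rewrite -coef_prod_linear; apply: (coef_log_deriv_power_sums char0).
  by rewrite coef_prod_linear multiple_sum0 mulr1.
rewrite scaleN1r -sumrN.
by apply: log_deriv_mod_prod => N; exact: log_deriv_mod_linear.
Qed.

Theorem theorem6p1 (R : realType) (m q n : nat) (a : nat -> complex R) :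
  recurrent_sum m q n a + (-1) ^+ m * multiple_sum m q n a =
    2 * \sum_(y : {ffun 'I_m -> 'I_m.+1} | is_partition y && ~~ odd (nb_parts y))
          partition_term q n a y
  /\
  recurrent_sum m q n a - (-1) ^+ m * multiple_sum m q n a =
    2 * \sum_(y : {ffun 'I_m -> 'I_m.+1} | is_partition y && odd (nb_parts y))
          partition_term q n a y.
Proof.
have char0 := Num.Theory.pchar_num (complex R).
rewrite (recurrent_sum_partitions char0) (multiple_sum_partitions char0).
split; rewrite mulr_sumr [RHS]big_mkcondr /=.
  rewrite -big_split /=; apply: eq_bigr => y _.
  rewrite -signr_odd; case: odd => /=; last by rewrite expr0; ring.
  by rewrite expr1; ring.
rewrite -sumrB; apply: eq_bigr => y _.
rewrite -signr_odd; case: odd => /=; last by rewrite expr0; ring.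
by rewrite expr1; ring.
Qed.
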